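(* Let $\mathfrak X:\mathcal P_3'\to\mathbb R^2$ be a function. Then $\mathfrak X$ is a center if and only if it satisfies any one (and then all) of the following equivalent properties (that is, ''$\mathfrak X$ is a center'', (a), (b) and (c) are all equivalent): (a) Let $\mathcal D_a=\{(a,b,c)\in\mathbb R^3: a<b+c,\ b<a+c,\ c<a+b\}$. There exists a function $g:\mathcal D_a\to\mathbb R$ which is positively homogeneous and satisfies $g(a,b,c)=g(a,c,b)$ for all $(a,b,c)\in\mathcal D_a$, such that for every $\{A,B,C\}\in\mathcal P_3'$, $$\mathfrak X(\{A,B,C\})=\frac{1}{g(a,b,c)+g(b,c,a)+g(c,a,b)}\bigl(g(a,b,c)A+g(b,c,a)B+g(c,a,b)C\bigr),$$ where $a$ is the length of $BC$, $b$ is the length of $AC$ and $c$ is the length of $AB$. (b) Let $\mathcal D_b=\{(A,B,C):\{A,B,C\}\in\mathcal P_3'\}$. There exists a function $g:\mathcal D_b\to\mathbb R$ which is positively homogeneous, invariant with respect to isometries, and satisfies $g(A,B,C)=g(A,C,B)$ for all $(A,B,C)\in\mathcal D_b$, such that for every $\{A,B,C\}\in\mathcal P_3'$, $$\mathfrak X(\{A,B,C\})=\frac{1}{g(A,B,C)+g(B,C,A)+g(C,A,B)}\bigl(g(A,B,C)A+g(B,C,A)B+g(C,A,B)C\bigr).$$ (c) Let $\mathcal D_c=\{(X,O):O\in\mathcal P_3',\ X\in O\}$. There exists a function $g:\mathcal D_c\to\mathbb R$ which is positively homogeneous and invariant with respect to isometries, such that for every $O=\{A,B,C\}\in\mathcal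 P_3'$, $$\mathfrak X(\{A,B,C\})=\frac{1}{g(A,O)+g(B,O)+g(C,O)}\bigl(g(A,O)A+g(B,O)B+g(C,O)C\bigr).$$
   Context: $S(2)$ denotes the group (under composition) of similarities of $\mathbb R^2$, i.e. maps $T:\mathbb R^2\to\mathbb R^2$ for which there is $r>0$ with $\|T(x)-T(y)\|=r\|x-y\|$ for all $x,y$. $\mathcal P_3'$ denotes the set of triangles in the plane, i.e. the set of subsets $\{A,B,C\}\subset\mathbb R^2$ of three distinct, non-collinear points; $S(2)$ acts on it by $T(\{A,B,C\})=\{T(A),T(B),T(C)\}$. A center is a function $\mathfrak X:\mathcal P_3'\to\mathbb R^2$ which is equivariant: $T(\mathfrak X(O))=\mathfrak X(T(O))$ for all $T\in S(2)$ and all $O\in\mathcal P_3'$ (no continuity is required). A function $g$ is positively homogeneous if, when all its arguments are multiplied by a positive scalar, its value is multiplied by some power of this scalar: there is a real number $k$ such that multiplying all arguments by any $t>0$ multiplies the value of $g$ by $t^k$. On $\mathcal D_b$ the scalar acts by $t(A,B,C)=(tA,tB,tC)$ and on $\mathcal D_c$ by $t(X,O)=(tX,tO)$, where $tO=\{tA,tB,tC\}$ for $O=\{A,B,C\}$. A function $g$ is invariant with respect to isometries if $g=g\circ T$ for every isometry $T$ of $\mathbb R^2$, where $T$ acts by $T(A,B,C)=(T(A),T(B),T(C))$ on $\mathcal D_b$ and by $T(X,O)=(T(X),T(O))$ on $\mathcal D_c$. In each of the displayed formulas the denominator is understood to be nonzero for every triangle. *)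

(* Defs.v *)
From mathcomp Require Import all_boot all_order all_algebra.
From mathcomp Require Import all_classical all_reals all_analysis.

Set Implicit Arguments.
Unset Strict Implicit.
Unset Printing Implicit Defensive.

Import Order.TTheory GRing.Theory Num.Theory.

Local Open Scope classical_set_scope.
Local Open Scope ring_scope.

(* Convention: a function defined on a domain D (a set of triangles, of
   triples, ...) is represented by a total function on the ambient type of
   which only the values on D are ever mentioned. *)

Section PlaneGeometry.
Variable R : realType.

Definition plane := 'rV[R]_2.

(* The library's norm on 'rV[R]_2 is the sup norm, hence this definition. *)
Definition enorm (u : plane) : R := Num.sqrt (\sum_(i < 2) u 0 i ^+ 2).

Definition edist (P Q : plane) : R := enorm (P - Q).

Definition similarity (T : plane -> plane) : Prop :=
  exists2 r : R, 0 < r & forall P Q, edist (T P) (T Q) = r * edist P Q.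

Definition plane_isometry (T : plane -> plane) : Prop :=
  forall P Q, edist (T P) (T Q) = edist P Q.

Definition line (P v : plane) : set plane := [set P + s *: v | s in setT].

Definition collinear (A B C : plane) : Prop :=
  exists P v : plane, v != 0 /\ [set A; B; C] `<=` line P v.

Definition triangles : set (set plane) :=
  [set tri | exists A B C : plane,
     [/\ uniq [:: A; B; C], ~ collinear A B C & tri = [set A; B; C]]].

Definition is_center (X : set plane -> plane) : Prop :=
  forall T, similarity T -> forall tri, triangles tri -> T (X tri) = X (T @` tri).

Definition positively_homogeneous (V : Type) (scale : R -> V -> V)
    (D : set V) (g : V -> R) : Prop :=
  exists k : R, forall (t : R) (x : V), 0 < t -> D x ->
    g (scale t x) = t `^ k * g x.

Definition isometry_invariant (V : Type) (act : (plane -> plane) -> V -> V)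
    (D : set V) (g : V -> R) : Prop :=
  forall T, plane_isometry T -> forall x : V, D x -> g (act T x) = g x.

(* The conjunct [w1 + w2 + w3 != 0] matters: division by 0 yields 0. *)
Definition is_weighted_mean (P : plane) (w1 w2 w3 : R) (A B C : plane) : Prop :=
  w1 + w2 + w3 != 0 /\
  P = (w1 + w2 + w3)^-1 *: (w1 *: A + w2 *: B + w3 *: C).

Definition domain_a : set (R * R * R) :=
  [set p | let: (a, b, c) := p in [/\ a < b + c, b < a + c & c < a + b]].

Definition scale_a (t : R) (p : R * R * R) : R * R * R :=
  let: (a, b, c) := p in (t * a, t * b, t * c).

Definition property_a (X : set plane -> plane) : Prop :=
  exists g : R * R * R -> R,
    [/\ positively_homogeneous scale_a domain_a g,
        forall a b c, domain_a (a, b, c) -> g (a, b, c) = g (a, c, b)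
      & forall A B C : plane, triangles [set A; B; C] ->
          let a := edist B C in
          let b := edist A C in
          let c := edist A B in
          is_weighted_mean (X [set A; B; C])
            (g (a, b, c)) (g (b, c, a)) (g (c, a, b)) A B C].

Definition domain_b : set (plane * plane * plane) :=
  [set p | let: (A, B, C) := p in triangles [set A; B; C]].

Definition act_b (T : plane -> plane) (p : plane * plane * plane) :
    plane * plane * plane :=
  let: (A, B, C) := p in (T A, T B, T C).

Definition property_b (X : set plane -> plane) : Prop :=
  exists g : plane * plane * plane -> R,
    [/\ positively_homogeneous (fun t => act_b (fun P => t *: P)) domain_b g,
        isometry_invariant act_b domain_b g,
        forall A B C, domain_b (A, B, C) -> g (A, B, C) = g (A, C, B)
      & forall A B C : plane, triangles [set A; B; C] ->
          is_weighted_mean (X [set A; B; C])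
            (g (A, B, C)) (g (B, C, A)) (g (C, A, B)) A B C].

Definition domain_c : set (plane * set plane) :=
  [set p | let: (P, tri) := p in triangles tri /\ tri P].

Definition act_c (T : plane -> plane) (p : plane * set plane) :
    plane * set plane :=
  let: (P, tri) := p in (T P, T @` tri).

Definition property_c (X : set plane -> plane) : Prop :=
  exists g : plane * set plane -> R,
    [/\ positively_homogeneous (fun t => act_c (fun P => t *: P)) domain_c g,
        isometry_invariant act_c domain_c g
      & forall A B C : plane, triangles [set A; B; C] ->
          let tri := [set A; B; C] in
          is_weighted_mean (X tri) (g (A, tri)) (g (B, tri)) (g (C, tri)) A B C].

End PlaneGeometry.

(* Main.v *)
From Pilot Require Import Defs.
From mathcomp Require Import all_boot all_order all_algebra.
From mathcomp Require Import all_classical all_reals all_analysis.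
From mathcomp Require Import ring lra.

(** A center is determined by the barycentric coordinates of its value, and
    these coordinates are similarity invariants of the triangle with one vertex
    singled out.  The statement is this remark read in both directions.

    From a center to (a): by [sss_congruence] the side lengths determine a
    triangle up to an isometry, so the barycentric coordinate of the center at
    a vertex depends only on the three side lengths ([center_weights_triangle]).
    This coordinate is the weight; it is homogeneous of degree 0, because a
    center commutes with scalings, and symmetric in the two sides that meet at
    the vertex, because a center ignores the order of the vertices.  Then (b)
    reads the weights of (a) off the side lengths, and the symmetry of the
    weight of (b) makes it a function of a vertex and the triangle only,
    which is (c).

    From (c) to a center: a similarity of ratio [r] is a scaling by [r] after an
    isometry, so it multiplies all three weights by the same power of [r], which
    a weighted mean does not notice; and a similarity maps weighted means to
    weighted means ([weighted_mean_similarity]).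

    Both geometric inputs, the affinity of similarities and the SSS criterion,
    come from one formula: when the coefficients sum to 0, the squared norm of
    a linear combination of points is a function of the mutual distances of
    these points ([leibniz_identity]).  Nondegeneracy is handled by the
    doubled signed area [cross], which Heron's formula expresses through
    distances up to sign. *)

Set Implicit Arguments.
Unset Strict Implicit.
Unset Printing Implicit Defensive.

(* Hides the extended distance of metric spaces, also called [edist]. *)
Import Pilot.Defs.
Import Order.TTheory GRing.Theory Num.Theory.

Local Open Scope classical_set_scope.
Local Open Scope ring_scope.

(** * Euclidean distance and weighted means *)

Section Centers.
Variable R : realType.
Implicit Types (A B C D E F P Q : plane R) (T : plane R -> plane R).
Implicit Types (X : set (plane R) -> plane R) (tri : set (plane R)).
Implicit Types a b c r s t w : R.

Lemma plane_ext P Q : P 0 0 = Q 0 0 -> P 0 1 = Q 0 1 -> P = Q.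
Proof.
move=> e0 e1; apply/rowP; case=> [[|[|//]]] i.
- by rewrite (_ : Ordinal i = 0) //; exact/val_inj.
- by rewrite (_ : Ordinal i = 1) //; exact/val_inj.
Qed.

Lemma enorm_ge0 P : 0 <= enorm P.
Proof. exact: sqrtr_ge0. Qed.

Lemma enorm_sqr P : enorm P ^+ 2 = P 0 0 ^+ 2 + P 0 1 ^+ 2.
Proof.
rewrite /enorm sqr_sqrtr; last by apply: sumr_ge0 => i _; exact: sqr_ge0.
rewrite !big_ord_recl big_ord0 addr0; congr (_ + P 0 _ ^+ 2).
exact/val_inj.
Qed.

Lemma edist_ge0 P Q : 0 <= edist P Q.
Proof. exact: enorm_ge0. Qed.

Lemma edist_sqr P Q :
  edist P Q ^+ 2 = (P 0 0 - Q 0 0) ^+ 2 + (P 0 1 - Q 0 1) ^+ 2.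
Proof. by rewrite /edist enorm_sqr !mxE. Qed.

Lemma edistC P Q : edist P Q = edist Q P.
Proof.
apply/eqP; rewrite -(@eqrXn2 R 2) ?edist_ge0 //; apply/eqP.
by rewrite !edist_sqr; ring.
Qed.

Lemma edist_eq0 P Q : edist P Q = 0 -> P = Q.
Proof.
move=> /(congr1 (fun x => x ^+ 2)); rewrite edist_sqr expr0n /= => /eqP.
rewrite paddr_eq0 ?sqr_ge0 // !sqrf_eq0 !subr_eq0 => /andP[/eqP e0 /eqP e1].
exact: plane_ext.
Qed.

Lemma edistZ t P Q : 0 <= t -> edist (t *: P) (t *: Q) = t * edist P Q.
Proof.
move=> t0; apply/eqP; rewrite -(@eqrXn2 R 2) ?mulr_ge0 ?edist_ge0 //.
by apply/eqP; rewrite exprMn !edist_sqr !mxE; ring.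
Qed.

(** Expanding the inner products [<P_i, P_j>] as
    [(|P_i|^2 + |P_j|^2 - |P_i - P_j|^2) / 2], the terms [|P_i|^2] cancel because
    the coefficients sum to 0, and only distances between the points survive. *)
Lemma leibniz_identity P A B C (p a b c : R) : p + a + b + c = 0 ->
  enorm (p *: P + a *: A + b *: B + c *: C) ^+ 2 =
  - (p * a * edist P A ^+ 2 + p * b * edist P B ^+ 2 + p * c * edist P C ^+ 2 +
     a * b * edist A B ^+ 2 + b * c * edist B C ^+ 2 + c * a * edist C A ^+ 2).
Proof.
move=> e; have -> : p = - (a + b + c) by lra.
by rewrite !edist_sqr enorm_sqr !mxE; ring.
Qed.

Lemma scaling_similarity t : 0 < t -> similarity (fun P => t *: P).
Proof. by move=> t0; exists t => // P Q; rewrite edistZ ?ltW. Qed.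

Lemma isometry_similarity T : plane_isometry T -> similarity T.
Proof. by move=> iT; exists 1 => // P Q; rewrite iT mul1r. Qed.

(** Splits a similarity into an isometry and a scaling, the two kinds of maps
    under which the weights of property (c) are controlled. *)
Lemma similarity_factor T r : 0 < r ->
  (forall P Q, edist (T P) (T Q) = r * edist P Q) ->
  plane_isometry (fun P => r^-1 *: T P).
Proof.
move=> r0 simT P Q; rewrite edistZ ?invr_ge0 ?ltW// simT mulKf//.
by rewrite gt_eqF.
Qed.

(** Being the mean [P] of [A], [B], [C] with weights of sum [s] means that
    [- s P + w1 A + w2 B + w3 C] has norm 0.  By [leibniz_identity] this is a
    homogeneous condition on distances, so a similarity preserves it: no
    linearity of [T] has to be established. *)
Lemma weighted_mean_similarity T P A B C w1 w2 w3 : similarity T ->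
  is_weighted_mean P w1 w2 w3 A B C ->
  is_weighted_mean (T P) w1 w2 w3 (T A) (T B) (T C).
Proof.
move=> [r r0 simT] [s0 defP]; split=> //.
set s := w1 + w2 + w3 in s0 defP *.
have s3 : w1 + w2 + w3 = s by []; clearbody s.
have e1 : - s + w1 + w2 + w3 = 0 by rewrite -s3; ring.
have P0 : enorm (- s *: P + w1 *: A + w2 *: B + w3 *: C) ^+ 2 = 0.
  rewrite -!addrA [w1 *: A + _]addrA defP scaleNr scalerA divff // scale1r.
  by rewrite addNr enorm_sqr !mxE; ring.
have TP0 : enorm (- s *: T P + w1 *: T A + w2 *: T B + w3 *: T C) ^+ 2 = 0.
  rewrite leibniz_identity // in P0; rewrite leibniz_identity // !simT.
  rewrite -(mulr0 (r ^+ 2)) -[in RHS]P0; ring.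
have := TP0; rewrite enorm_sqr => /eqP.
rewrite paddr_eq0 ?sqr_ge0 // !sqrf_eq0 !mxE => /andP[/eqP h0 /eqP h1].
apply: plane_ext; rewrite !mxE; apply: (mulfI s0); rewrite mulVKf //.
  by rewrite -[LHS]add0r -h0; ring.
by rewrite -[LHS]add0r -h1; ring.
Qed.

Lemma weighted_mean_scale s P A B C w1 w2 w3 : s != 0 ->
  is_weighted_mean P w1 w2 w3 A B C ->
  is_weighted_mean P (s * w1) (s * w2) (s * w3) A B C.
Proof.
move=> s0 [w0 defP]; have e : s * w1 + s * w2 + s * w3 = s * (w1 + w2 + w3).
  by ring.
split; first by rewrite e mulf_neq0.
rewrite e {1}defP -!scalerA -!scalerDr scalerA; congr (_ *: _).
by rewrite invfM mulrAC mulVf ?mul1r.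
Qed.

(** * Nondegeneracy of triangles *)

(** Twice the signed area of the triangle. *)
Definition cross A B C : R :=
  (B 0 0 - A 0 0) * (C 0 1 - A 0 1) - (B 0 1 - A 0 1) * (C 0 0 - A 0 0).

Lemma crossC A B C : cross A C B = - cross A B C.
Proof. by rewrite /cross; ring. Qed.

Lemma cross_rot A B C : cross B C A = cross A B C.
Proof. by rewrite /cross; ring. Qed.

(** Heron's formula in the polynomial form [4 b^2 c^2 - (2 b c cos A)^2], which
    makes the area, hence nondegeneracy, a function of distances. *)
Lemma heron A B C :
  let a := edist B C in let b := edist A C in let c := edist A B in
  4 * cross A B C ^+ 2 = 4 * b ^+ 2 * c ^+ 2 - (b ^+ 2 + c ^+ 2 - a ^+ 2) ^+ 2.
Proof. by rewrite /= !edist_sqr /cross; ring. Qed.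

Lemma collinear_cross0 A B C : collinear A B C -> cross A B C = 0.
Proof.
move=> [P [v [_ ABC]]].
have [x _ <-] : line P v A by apply: ABC; left; left.
have [y _ <-] : line P v B by apply: ABC; left; right.
have [z _ <-] : line P v C by apply: ABC; right.
by rewrite /cross !mxE; ring.
Qed.

Lemma cross0_collinear A B C : cross A B C = 0 -> collinear A B C.
Proof.
wlog AB : A B C / A != B.
  move=> wl; have [eAB|] := eqVneq A B; last exact: wl.
  have [eAC _|nAC cr] := eqVneq A C.
    exists A, (const_mx 1); split.
      apply/eqP => /(congr1 (fun u : plane R => u 0 0)); rewrite !mxE.
      by apply/eqP; rewrite oner_eq0.
    by move=> Q Qtri; exists 0 => //; rewrite scale0r addr0;
      case: Qtri => [[]|] ->.
  have [|P [v [v0 sub]]] := wl A C B nAC; first by rewrite crossC cr oppr0.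
  exists P, v; split=> // Q Qtri; apply: sub.
  by case: Qtri => [[]|] ->; [left; left|right|left; right].
move=> cr; exists A, (B - A); split; first by rewrite subr_eq0 eq_sym.
have d0 : edist A B ^+ 2 != 0.
  by rewrite sqrf_eq0; apply: contraNneq AB => /edist_eq0 ->.
rewrite /cross in cr.
rewrite edist_sqr in d0.
(* The parameter of [C] on the line [A B] is <C - A, B - A> / |B - A|^2; the
   coordinates of [C] are then checked modulo the equation [cr]. *)
pose x := (C 0 0 - A 0 0) * (B 0 0 - A 0 0) + (C 0 1 - A 0 1) * (B 0 1 - A 0 1).
move=> Q [[|]|] ->.
- by exists 0; rewrite // scale0r addr0.
- by exists 1; rewrite // scale1r addrC subrK.
exists (x / ((A 0 0 - B 0 0) ^+ 2 + (A 0 1 - B 0 1) ^+ 2)) => //.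
apply: plane_ext; rewrite !mxE; apply: (mulfI d0).
- rewrite mulrDr mulrA mulrCA divff // mulr1 /x.
  apply/eqP; rewrite -subr_eq0; apply/eqP.
  by rewrite -[RHS](mulr0 (B 0 1 - A 0 1)) -[in RHS]cr; ring.
- rewrite mulrDr mulrA mulrCA divff // mulr1 /x.
  apply/eqP; rewrite -subr_eq0; apply/eqP.
  by rewrite -[RHS](mulr0 (A 0 0 - B 0 0)) -[in RHS]cr; ring.
Qed.

(** Membership in [triangles] only provides some enumeration of the set by
    noncollinear points; collinearity depends on the set alone, so it transfers
    to the enumeration at hand. *)
Lemma triangle_cross A B C : triangles [set A; B; C] <-> cross A B C != 0.
Proof.
split=> [[A' [B' [C' [_ ncol eqtri]]]]|cr].
  apply/eqP => /cross0_collinear [P [v [v0 sub]]]; apply: ncol.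
  by exists P, v; rewrite -eqtri.
exists A, B, C; split=> //; last first.
  by move=> /collinear_cross0 e; rewrite e eqxx in cr.
rewrite /= !inE andbT negb_or -!andbA; apply/and3P.
by split; apply: contraNneq cr => ->; apply/eqP; rewrite /cross; ring.
Qed.

Lemma set3C A B C : [set A; C; B] = [set A; B; C].
Proof. exact: setUAC. Qed.

Lemma set3_rot A B C : [set B; C; A] = [set A; B; C].
Proof. by rewrite setUC setUA. Qed.

Lemma image_set3 T A B C : T @` [set A; B; C] = [set T A; T B; T C].
Proof. by rewrite !image_setU !image_set1. Qed.

(** A similarity multiplies the right-hand side of [heron] by [r ^+ 4]. *)
Lemma triangle_similarity T tri :
  similarity T -> triangles tri -> triangles (T @` tri).
Proof.
move=> [r r0 simT] tritri; case: (tritri) => A [B [C [_ _ deftri]]].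
move: tritri; rewrite {}deftri image_set3 !triangle_cross.
apply: contra_neq => cr.
have := heron (T A) (T B) (T C); rewrite /= !simT cr => hT.
apply/eqP; rewrite -sqrf_eq0; apply/eqP.
have h := heron A B C; rewrite /= in h.
have r4 : r ^+ 4 * 4 != 0 by rewrite mulf_neq0 ?expf_neq0 ?gt_eqF ?ltr0n.
apply: (mulfI r4); rewrite -mulrA h mulr0.
transitivity (4 * 0 ^+ 2 : R); last by ring.
by rewrite hT; ring.
Qed.

(** Heron's product
    [(a + b + c) (b + c - a) (a - b + c) (a + b - c)] is positive, whereas
    [b + c <= a] would make one factor nonpositive and the others nonnegative. *)
Lemma triangle_strict_ineq A B C : triangles [set A; B; C] ->
  edist B C < edist A C + edist A B.
Proof.
rewrite triangle_cross => cr; have := heron A B C => /=.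
have := edist_ge0 B C; have := edist_ge0 A C; have := edist_ge0 A B.
move: (edist B C) (edist A C) (edist A B) => a b c c0 b0 a0 h.
rewrite ltNge; apply/negP => le_a.
have : 0 < 4 * cross A B C ^+ 2 by rewrite mulr_gt0 ?exprn_even_gt0.
apply/negP; rewrite -leNgt h.
have -> : 4 * b ^+ 2 * c ^+ 2 - (b ^+ 2 + c ^+ 2 - a ^+ 2) ^+ 2 =
    - ((a + b + c) * (a - (b + c)) * ((a - b + c) * (a + b - c))) by ring.
by rewrite oppr_le0 !mulr_ge0 //; lra.
Qed.

Lemma triangle_sides A B C : triangles [set A; B; C] ->
  domain_a (edist B C, edist A C, edist A B).
Proof.
move=> tri; split; first exact: triangle_strict_ineq.
- rewrite addrC (edistC A C) (edistC A B).
  by apply: triangle_strict_ineq; rewrite (set3_rot A B C).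
- rewrite (edistC A C) (edistC B C).
  by apply: triangle_strict_ineq; rewrite -(set3_rot C A B).
Qed.

(** * Barycentric coordinates and congruence *)

(** The barycentric coordinate of [P] at the first vertex; those at the other
    vertices are [bary B C A P] and [bary C A B P]. *)
Definition bary A B C P : R := cross P B C / cross A B C.

Lemma baryC A B C P : bary A C B P = bary A B C P.
Proof. by rewrite /bary (crossC A) (crossC P) invrN mulrNN. Qed.

Lemma bary_sum A B C P : cross A B C != 0 ->
  bary A B C P + bary B C A P + bary C A B P = 1.
Proof.
move=> cr; rewrite /bary (cross_rot A B C) -(cross_rot C A B) -!mulrDl.
by apply: (mulIf cr); rewrite mulfVK // mul1r /cross; ring.
Qed.

Lemma bary_mean A B C P : cross A B C != 0 ->
  is_weighted_mean P (bary A B C P) (bary B C A P) (bary C A B P) A B C.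
Proof.
move=> cr; split; first by rewrite bary_sum ?oner_eq0.
rewrite bary_sum // invr1 scale1r /bary (cross_rot A B C) -(cross_rot C A B).
by apply: plane_ext; rewrite !mxE; apply: (mulfI cr);
  rewrite !mulrDr ![cross A B C * (_ / _ * _)]mulrA
    ![cross A B C * (_ / _)]mulrCA divff // !mulr1 /cross; ring.
Qed.

(** Uniqueness of barycentric coordinates: normalized weights are recovered as
    ratios of areas. *)
Lemma mean_bary A B C P w1 w2 w3 : cross A B C != 0 ->
  is_weighted_mean P w1 w2 w3 A B C -> bary A B C P = w1 / (w1 + w2 + w3).
Proof.
move=> cr [w0 ->]; apply: (mulIf cr); rewrite mulfVK //.
by rewrite /cross !mxE; field.
Qed.

Lemma bary_similarity T A B C P : similarity T -> triangles [set A; B; C] ->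
  bary (T A) (T B) (T C) (T P) = bary A B C P.
Proof.
move=> simT tri; have := triangle_similarity simT tri.
rewrite image_set3 => /triangle_cross crT; have /triangle_cross cr := tri.
rewrite (mean_bary crT (weighted_mean_similarity simT (bary_mean P cr))).
by rewrite bary_sum // divr1.
Qed.

(** The map keeping barycentric coordinates, from [A B C] to [A' B' C'].  The
    difference of two points is a combination of the vertices with coefficients
    of sum 0, so by [leibniz_identity] its norm depends only on the three side
    lengths, which agree. *)
Lemma sss_congruence A B C A' B' C' : triangles [set A; B; C] ->
  edist A' B' = edist A B -> edist B' C' = edist B C ->
  edist C' A' = edist C A ->
  exists2 T, plane_isometry T & [/\ T A = A', T B = B' & T C = C'].
Proof.
move=> /triangle_cross cr eAB eBC eCA.
exists (fun P => bary A B C P *: A' + bary B C A P *: B' + bary C A B P *: C').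
  move=> P Q; apply/eqP; rewrite -(@eqrXn2 R 2) ?edist_ge0 //; apply/eqP.
  pose x := bary A B C P - bary A B C Q.
  pose y := bary B C A P - bary B C A Q.
  pose z := bary C A B P - bary C A B Q.
  have xyz : 0 + x + y + z = 0.
    transitivity ((bary A B C P + bary B C A P + bary C A B P) -
      (bary A B C Q + bary B C A Q + bary C A B Q)).
      by rewrite /x /y /z; ring.
    by rewrite !bary_sum // subrr.
  have mean D : D = bary A B C D *: A + bary B C A D *: B + bary C A B D *: C.
    by have [_] := bary_mean D cr; rewrite bary_sum // invr1 scale1r.
  have -> : edist P Q = enorm (0 *: A + x *: A + y *: B + z *: C).
    rewrite /edist {1}(mean P) {1}(mean Q); congr enorm.
    by apply: plane_ext; rewrite /x /y /z !mxE; ring.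
  (* The identity is about four points; the fourth is a copy of the first
     vertex with coefficient 0. *)
  rewrite leibniz_identity // [edist (_ + _) _]/edist.
  have -> : bary A B C P *: A' + bary B C A P *: B' + bary C A B P *: C' -
      (bary A B C Q *: A' + bary B C A Q *: B' + bary C A B Q *: C') =
      0 *: A' + x *: A' + y *: B' + z *: C'.
    by apply: plane_ext; rewrite /x /y /z !mxE; ring.
  by rewrite leibniz_identity // eAB eBC eCA; ring.
have bary1 D E F : cross D E F != 0 -> bary D E F D = 1.
  by move=> ?; rewrite /bary divff.
have bary0 D E F : bary D E F E = 0.
  by rewrite /bary [cross E E F](_ : _ = 0) ?mul0r // /cross; ring.
have bary0' D E F : bary D E F F = 0 by rewrite -baryC bary0.
have crB : cross B C A != 0 by rewrite cross_rot.
have crC : cross C A B != 0 by rewrite cross_rot.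
by split; rewrite ?bary1 // ?bary0 ?bary0' ?scale0r ?scale1r ?add0r ?addr0.
Qed.

(** * Weights of a center *)

(** The possible weights at the vertex opposite to the first side of [p].  It is
    a set because no triangle is chosen for the triple [p]: for a center, it is
    a singleton when [p] consists of the sides of a triangle; it is empty when
    there is no such triangle.
    Symmetry and homogeneity of the weight then hold as equalities of sets,
    whether or not [p] bounds a triangle. *)
Definition center_weights X (p : R * R * R) : set R :=
  [set w | exists A B C, [/\ triangles [set A; B; C],
     p = (edist B C, edist A C, edist A B)
   & w = bary A B C (X [set A; B; C])]].

Lemma center_weights_swap X a b c :
  center_weights X (a, b, c) = center_weights X (a, c, b).
Proof.
suff sub x y z : center_weights X (x, y, z) `<=` center_weights X (x, z, y).
  by rewrite eqEsubset; split.
move=> w [A [B [C [tri [-> -> ->] ->]]]]; exists A, C, B.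
by rewrite set3C baryC edistC.
Qed.

Lemma center_weights_scale X t p : is_center X -> 0 < t ->
  center_weights X (scale_a t p) = center_weights X p.
Proof.
move=> cX; have sub s q : 0 < s ->
    center_weights X q `<=` center_weights X (scale_a s q).
  move=> s0 w [A [B [C [tri -> ->]]]].
  have simS := scaling_similarity s0.
  exists (s *: A), (s *: B), (s *: C); split.
  - by have := triangle_similarity simS tri; rewrite image_set3.
  - by rewrite /scale_a !edistZ ?ltW.
  - rewrite -(image_set3 (fun P => s *: P)) -(cX _ simS) //.
    by rewrite (bary_similarity _ simS).
move=> t0; rewrite eqEsubset; split; last exact: sub.
have {2}-> : p = scale_a t^-1 (scale_a t p).
  case: p => -[a b] c; rewrite /scale_a !mulKf ?gt_eqF //.
by apply: sub; rewrite invr_gt0.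
Qed.

(** Two triangles with the same sides are exchanged by an isometry
    ([sss_congruence]), which carries the center of one to the center of the
    other and keeps barycentric coordinates. *)
Lemma center_weights_triangle X A B C :
  is_center X -> triangles [set A; B; C] ->
  center_weights X (edist B C, edist A C, edist A B) =
  [set bary A B C (X [set A; B; C])].
Proof.
move=> cX tri; rewrite eqEsubset; split=> w /=.
  2: by move=> ->; exists A, B, C.
move=> [A' [B' [C' [tri' [eBC eAC eAB] ->]]]].
have [||| T isoT [TA TB TC]] := @sss_congruence A B C A' B' C' tri => //.
  by rewrite edistC -eAC edistC.
have simT := isometry_similarity isoT.
by rewrite -TA -TB -TC -image_set3 -(cX _ simT) // bary_similarity.
Qed.

(** The weights are already normalized, so their degree of homogeneity is 0. *)
Lemma center_property_a X : is_center X -> property_a X.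
Proof.
move=> cX; exists (fun p => xget 0 (center_weights X p)); split.
- by exists 0 => t p t0 _; rewrite powRr0 mul1r center_weights_scale.
- by move=> a b c _; rewrite center_weights_swap.
move=> A B C tri a b c.
have triB : triangles [set B; C; A] by rewrite set3_rot.
have triC : triangles [set C; A; B] by rewrite -(set3_rot C A B).
have wA := center_weights_triangle cX tri.
have wB := center_weights_triangle cX triB.
have wC := center_weights_triangle cX triC.
rewrite (edistC C A) (edistC B A) in wB.
rewrite (edistC C B) (edistC C A) in wC.
have xget1 w : xget 0 [set w] = w by exact: xget_unique.
rewrite /a /b /c wA wB wC !xget1.
rewrite (set3_rot A B C) -(set3_rot C A B).
by apply: bary_mean; apply/triangle_cross.
Qed.

(** * From sides to vertices to points of the triangle *)

Lemma property_a_b X : property_a X -> property_b X.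
Proof.
move=> [g [[k homg] symg meang]].
exists (fun q => let: (A, B, C) := q in g (edist B C, edist A C, edist A B)).
split.
- exists k => t [[A B] C] t0 tri /=; rewrite !edistZ ?ltW //.
  by rewrite -(homg t _ t0 (triangle_sides tri)).
- by move=> T isoT [[A B] C] _ /=; rewrite !isoT.
- move=> A B C tri; rewrite (edistC C B); exact: symg (triangle_sides tri).
- move=> A B C tri; have := meang A B C tri => /=.
  by rewrite (edistC C A) (edistC B A) (edistC C B).
Qed.

(** The other two vertices are determined up to order by the triangle and one
    of its vertices: this is the ambiguity that the symmetry of the weight of
    property (b) absorbs. *)
Lemma set3_inj A B C B' C' : triangles [set A; B; C] ->
  [set A; B; C] = [set A; B'; C'] ->
  (B' = B /\ C' = C) \/ (B' = C /\ C' = B).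
Proof.
move=> tri e; have tri' := tri; rewrite e in tri'.
have nondeg D E F : triangles [set D; E; F] -> [/\ E != D, F != D & E != F].
  move=> /triangle_cross cr.
  by split; apply: contraNneq cr => ->; apply/eqP; rewrite /cross; ring.
have [/eqP nB' /eqP nC' /eqP nBC'] := nondeg _ _ _ tri'.
have inB' : [set A; B; C] B' by rewrite e; left; right.
have inC' : [set A; B; C] C' by rewrite e; right.
case: inB' => [[//|]|] eB'; case: inC' => [[//|]|] eC'; [|by left|by right|].
- by case: nBC'; rewrite eB' eC'.
- by case: nBC'; rewrite eB' eC'.
Qed.

Lemma triangle_vertex P tri : domain_c (P, tri) ->
  exists B C, tri = [set P; B; C].
Proof.
move=> [[A [B [C [_ _ ->]]]] [[|]|] ->]; first by exists B, C.
- by exists C, A; rewrite (set3_rot A B C).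
- by exists A, B; rewrite -(set3_rot C A B).
Qed.

Lemma property_b_c X : property_b X -> property_c X.
Proof.
move=> [g [[k homg] invg symg meang]].
pose W (q : plane R * set (plane R)) : set R :=
  [set w | exists B C, q.2 = [set q.1; B; C] /\ w = g (q.1, B, C)].
have WE A B C : triangles [set A; B; C] ->
    xget 0 (W (A, [set A; B; C])) = g (A, B, C).
  move=> tri; apply: xget_unique; first by exists B, C.
  move=> _ [B' [C' [/= e ->]]].
  by have [[-> ->]|[-> ->]] := set3_inj tri e => //; rewrite (symg A B C).
exists (fun q => xget 0 (W q)); split.
- exists k => t [P tri] t0 Ptri; have [tritri _] := Ptri.
  have [B [C e]] := triangle_vertex Ptri; rewrite {}e in tritri *.
  have := triangle_similarity (scaling_similarity t0) tritri.
  rewrite /act_c image_set3 => triS; rewrite !WE //.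
  exact: (homg t (P, B, C) t0 tritri).
- move=> T isoT [P tri] Ptri; have [tritri _] := Ptri.
  have [B [C e]] := triangle_vertex Ptri; rewrite {}e in tritri *.
  have := triangle_similarity (isometry_similarity isoT) tritri.
  rewrite /act_c image_set3 => triT; rewrite !WE //.
  exact: invg isoT (P, B, C) tritri.
move=> A B C tri /=; have := meang A B C tri.
have triB : triangles [set B; C; A] by rewrite set3_rot.
have triC : triangles [set C; A; B] by rewrite -(set3_rot C A B).
by rewrite -(WE _ _ _ tri) -(WE _ _ _ triB) -(WE _ _ _ triC)
  (set3_rot A B C) -(set3_rot C A B).
Qed.

(** * Back to centers *)

(** With [T] equal to [r] times an isometry, the weights of [T @` tri] are those
    of [tri] multiplied by the common nonzero factor [r `^ k]. *)
Lemma property_c_center X : property_c X -> is_center X.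
Proof.
move=> [g [[k homg] invg meang]] T simT tri tritri.
have [r r0 distT] := simT.
have gT P : tri P -> g (T P, T @` tri) = r `^ k * g (P, tri).
  move=> triP; have isoS := similarity_factor r0 distT.
  have triS := triangle_similarity (isometry_similarity isoS) tritri.
  rewrite -(invg _ isoS (P, tri)) // -homg //; last first.
    by split; [exact: triS|exists P].
  have rS Q : r *: (r^-1 *: T Q) = T Q.
    by rewrite scalerA divff ?scale1r ?gt_eqF.
  rewrite /act_c rS image_comp; congr (g (_, _)); congr (_ @` _).
  by apply/funext => Q /=; rewrite rS.
have triT := triangle_similarity simT tritri.
have [A [B [C [_ _ e]]]] := tritri; rewrite {}e in tritri gT triT *.
have [_ ->] : is_weighted_mean (X (T @` [set A; B; C]))
    (r `^ k * g (A, [set A; B; C])) (r `^ k * g (B, [set A; B; C]))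
    (r `^ k * g (C, [set A; B; C])) (T A) (T B) (T C).
  rewrite -!gT; [|by right|by left; right|by left; left].
  by move: triT; rewrite image_set3; exact: meang.
have rk0 : r `^ k != 0 by rewrite gt_eqF ?powR_gt0.
by have [_] := weighted_mean_scale rk0
  (weighted_mean_similarity simT (meang A B C tritri)).
Qed.

End Centers.

Theorem theorem3p1 (R : realType) (X : set (plane R) -> plane R) :
  [<-> is_center X; property_a X; property_b X; property_c X].
Proof.
tfae.
- exact: center_property_a.
- exact: property_a_b.
- exact: property_b_c.
- exact: property_c_center.
Qed.
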